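(* Let $(X,d)$ be a complete metric space and $(Y,\varrho)$ be a metric space. Let $\kappa>0$ and $\hat\kappa\ge\kappa$ be constants, let $W\subset X\times Y$, and let $F:X\rightrightarrows Y$ be a set-valued mapping with a closed graph such that $\operatorname{dom}F\cap W_X\ne\emptyset$. Equip $X\times Y$ with the metric $$\omega((u,v),(x,y)):=d(u,x)+\kappa\,\varrho(v,y),\qquad (u,v),(x,y)\in X\times Y,$$ so that distances to $\operatorname{gph}F$ below are taken with respect to $\omega$. Assume that for each $u\in X$ and each $y\in W_Y$ such that $$0<\operatorname{dist}\big((u,y),\operatorname{gph}F\big)\le\kappa\operatorname{dist}\big(y,F(x)\big)-\frac{\kappa}{\hat\kappa}\,d(u,x)\quad\text{for some }x\in W_{\cdot,y},$$ there is a $\hat u\in X$ satisfying $$\operatorname{dist}\big((\hat u,y),\operatorname{gph}F\big)<\operatorname{dist}\big((u,y),\operatorname{gph}F\big)-\frac{\kappa}{\hat\kappa}\,d(\hat u,u).$$ Then $F$ is regular on $W$ with the constant $\hat\kappa$.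
   Context: For $W\subset X\times Y$: $W_X:=\{x\in X:\ (x,y)\in W\text{ for some }y\in Y\}$, $W_Y:=\{y\in Y:\ (x,y)\in W\text{ for some }x\in X\}$, and $W_{\cdot,y}:=\{x\in X:\ (x,y)\in W\}$ for $y\in Y$. For a set-valued mapping $F:X\rightrightarrows Y$: $\operatorname{gph}F=\{(x,y)\in X\times Y: y\in F(x)\}$, $\operatorname{dom}F=\{x\in X:F(x)\ne\emptyset\}$, $F^{-1}(y)=\{x\in X: y\in F(x)\}$. Convention: $\inf\emptyset=\infty$, so $\operatorname{dist}(x,C)=\inf\{d(x,u):u\in C\}$ equals $\infty$ if $C=\emptyset$. $F$ is regular on $W$ with the constant $\hat\kappa$ if $\operatorname{dist}(x,F^{-1}(y))\le\hat\kappa\operatorname{dist}(y,F(x))$ for each $(x,y)\in W$. *)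

(* Defs.v *)
From HB Require Import structures.
From mathcomp Require Import all_boot all_order all_algebra.
From mathcomp Require Import all_classical all_reals all_analysis.

Set Implicit Arguments.
Unset Strict Implicit.
Unset Printing Implicit Defensive.

Import Order.TTheory GRing.Theory Num.Theory.
Import numFieldNormedType.Exports.

Local Open Scope classical_set_scope.
Local Open Scope ring_scope.

(* The library's [completeType] is necessarily pointed; this predicate states
   completeness of a metric space without choosing a base point. *)
Definition complete_metric (R : realType) (X : metricType R) : Prop :=
  forall u : nat -> X, cauchy (u @ \oo) -> exists l : X, u @ \oo --> l.

(* [dist d x C] is +oo when [C] is empty, since [ereal_inf set0 = +oo]. The
   distance function [d] is an explicit argument because several metrics are
   used. *)
Definition dist (R : realType) (T : Type) (d : T -> T -> R) (x : T)
    (C : set T) : \bar R :=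
  ereal_inf [set (d x u)%:E | u in C].

Section SetValued.
Variables (X Y : Type) (F : X -> set Y).

Definition gph : set (X * Y) := [set p | F p.1 p.2].

Definition dom : set X := [set x | F x !=set0].

Definition inv_image (y : Y) : set X := [set x | F x y].

End SetValued.

Definition omega (R : realType) (X Y : metricType R) (kappa : R)
    (p q : X * Y) : R :=
  mdist p.1 q.1 + kappa * mdist p.2 q.2.

Definition regular_on (R : realType) (X Y : metricType R) (F : X -> set Y)
    (W : set (X * Y)) (khat : R) : Prop :=
  forall (x : X) (y : Y), W (x, y) ->
    (dist mdist x (inv_image F y) <= khat%:E * dist mdist y (F x))%E.

(* Main.v *)
Require Import Defs.
From HB Require Import structures.
From mathcomp Require Import all_boot all_order all_algebra.
From mathcomp Require Import all_classical all_reals all_analysis.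
From mathcomp Require Import lra.

(* Write phi u := dist((u, y), gph F) for fixed (x, y) in W. It is
   1-Lipschitz and phi x <= kappa * dist(y, F x). Ekeland's principle with
   slope c := kappa / khat gives u with phi u + c d(u, x) <= phi x at which phi
   admits no descent of slope c. The descent hypothesis then forces phi u = 0,
   so y \in F u by closedness, and c d(u, x) <= kappa * dist(y, F x), that is,
   d(u, x) <= khat * dist(y, F x). *)

Set Implicit Arguments.
Unset Strict Implicit.
Unset Printing Implicit Defensive.

Import Order.TTheory GRing.Theory Num.Theory.
Import numFieldNormedType.Exports.

Local Open Scope classical_set_scope.
Local Open Scope ring_scope.

(** By the triangle inequality, [f v + c * mdist v u <= f u] is a preorder. Along a descending chain
    [f] converges, being bounded below, and its decrease controls the distances, so the chain is
    Cauchy. The non-strict minimality obtained here is enough to contradict a strict descent. *)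
Lemma ekeland (R : realType) (X : metricType R) (f : X -> R) (c m : R) (x : X) :
  complete_metric X -> continuous f -> 0 < c -> (forall u, m <= f u) ->
  exists2 u, f u + c * mdist u x <= f x &
    forall v, f u <= f v + c * mdist v u.
Proof.
move=> Xcomplete fcont c0 mf.
pose below (u : X) : set X := [set v | f v + c * mdist v u <= f u].
have below_refl u : below u u by rewrite /below/= mdistxx mulr0 addr0.
have below_trans u v w : below u v -> below v w -> below u w.
  rewrite /below/= => uv vw; have := metric_triangle w v u.
  by rewrite -(ler_pM2l c0) => ?; lra.
have below_le u v : below u v -> f v <= f u.
  by apply: le_trans; rewrite lerDl mulr_ge0 ?mdist_ge0 // ltW.
have next n u : {v | below u v /\
    forall w, below u w -> f v <= f w + n.+1%:R^-1}.
  apply: cid; have infu : has_inf (f @` below u).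
    by split; [exists (f u), u | exists m => _ [v _ <-]].
  have [||_ [v uv <-] fv] := @inf_adherent _ (f @` below u) n.+1%:R^-1.
  - by rewrite invr_gt0.
  - by [].
  exists v; split=> // w uw; apply/ltW/(lt_le_trans fv).
  by rewrite lerD2r; apply: ge_inf; [case: infu | exists w].
(* [u n.+1] minimizes [f] on [below (u n)] up to [1 / n.+1]. The limit lies in
   every [below (u n)], as does any point below it, which therefore cannot have
   a smaller value of [f]. *)
pose u n := iteri n (fun k v => sval (next k v)) x.
have uS n : below (u n) (u n.+1) by rewrite /u iteriS; case: (next _ _) => v [].
have umin n w : below (u n) w -> f (u n.+1) <= f w + n.+1%:R^-1.
  by case: (svalP (next n (u n))) => _; exact.
have umono n k : (n <= k)%N -> below (u n) (u k).
  move=> /subnK <-; elim: (k - n)%N => [|i ih]; first exact: below_refl.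
  by rewrite addSn; apply: below_trans (uS _).
have fu_cvg : cvgn (f \o u).
  apply: nonincreasing_is_cvgn; last by exists m => _ [n _ <-] /=.
  by move=> n k nk; exact/below_le/umono.
have u_cauchy : cauchy (u @ \oo).
  apply/cauchy_ballP => e e0.
  (* If [f (u k)] and [f (u N)] are both within [c * e / 4] of the limit, their difference is below
     [c * e / 2]. It bounds [c * mdist (u k) (u N)], so any two terms of the tail, compared through
     [u N], are within [e]. *)
  have /cvgrPdist_lt/(_ (c * e / 4)) := fu_cvg.
  rewrite !mulr_gt0 // => /(_ isT) [N _ HN].
  have near_uN k : (N <= k)%N -> mdist (u k) (u N) < e / 2.
    move=> Nk; have := umono _ _ Nk; rewrite /below/= => le_k.
    have /= := HN N (leqnn N); have /= := HN k Nk.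
    rewrite !ltr_norml => /andP[_ ?] /andP[? _].
    by rewrite -(ltr_pM2l c0); lra.
  exists ([set v | mdist v (u N) < e / 2], [set v | mdist v (u N) < e / 2]).
    by split; exists N => // k /near_uN.
  move=> [a b] [/= ha hb]; rewrite ballEmdist /=.
  have := metric_triangle a (u N) b; rewrite (metric_sym (u N) b); lra.
have [l ul] := Xcomplete u u_cauchy.
have fl : f (u k) @[k --> \oo] --> f l.
  by apply: continuous_cvg => //; exact: fcont.
have lbelow n : below (u n) l.
  rewrite /below/=; apply/ler_addgt0Pl => e e0.
  (* The error [e] is split evenly: [e / 2] for replacing [f l] by [f (u k)], and [c * (e / 2 / c)]
     for replacing [l] by [u k] in the distance. *)
  have e20 : 0 < e / 2 by rewrite divr_gt0.
  have ec0 : 0 < e / 2 / c by rewrite divr_gt0.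
  have /cvgrPdist_lt/(_ _ e20) near_f := fl.
  have /metricType_numDomainType.cvgrPdist_lt/(_ _ ec0) near_u := ul.
  have [k [[/= fk uk] nk]] :=
    filter_ex (filterI (filterI near_f near_u) (nbhs_infty_ge n)).
  have := umono _ _ nk; rewrite /below/= => le_k.
  move: fk; rewrite ltr_norml => /andP[_ fk].
  move: uk; rewrite ltr_pdivlMr // mulrC => uk.
  have := metric_triangle l (u k) (u n); rewrite -(ler_pM2l c0); lra.
exists l; first exact: lbelow 0%N.
move=> v; rewrite leNgt; apply/negP => lv.
have vbelow n : below (u n) v by apply: below_trans (lbelow n) _; exact: ltW.
have : f l <= f v.
  apply/ler_addgt0Pr => e e0.
  have [n _ /(_ n (leqnn n)) ne] := near_infty_natSinv_lt (PosNum e0).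
  apply: (le_trans (below_le _ _ (lbelow n.+1))).
  by apply: (le_trans (umin _ _ (vbelow n))); rewrite lerD2l; exact: ltW.
apply/negP; rewrite -ltNge; apply: le_lt_trans lv.
by rewrite lerDl mulr_ge0 ?mdist_ge0 // ltW.
Qed.

Section Dist.
Variables (R : realType) (T : Type) (d : T -> T -> R).

Lemma dist_le (x u : T) (C : set T) : C u -> (dist d x C <= (d x u)%:E)%E.
Proof. by move=> Cu; apply: ereal_inf_lbound; exists u. Qed.

Lemma dist_lt (x : T) (C : set T) (r : R) :
  (dist d x C < r%:E)%E -> exists2 u, C u & d x u < r.
Proof. by move=> /ereal_inf_lt[_ [u Cu <-]]; rewrite lte_fin; exists u. Qed.

Lemma dist_ge0 (x : T) (C : set T) :
  (forall u, 0 <= d x u) -> (0 <= dist d x C)%E.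
Proof. by move=> d0; apply/ereal_infP => _ [u _ <-]; rewrite lee_fin. Qed.

Lemma dist_set0 (x : T) : dist d x set0 = +oo%E.
Proof. by rewrite /dist image_set0 ereal_inf0. Qed.

Lemma dist_fin_num (x : T) (C : set T) : (forall u, 0 <= d x u) ->
  C !=set0 -> dist d x C \is a fin_num.
Proof.
move=> d0 [u Cu]; rewrite ge0_fin_numE ?dist_ge0 //.
exact: le_lt_trans (dist_le x Cu) (ltry _).
Qed.

End Dist.

Section Omega.
Variables (R : realType) (X Y : metricType R) (kappa : R).
Hypothesis kappa_gt0 : 0 < kappa.
Variable F : X -> set Y.

Lemma omega_ge0 (p q : X * Y) : 0 <= omega kappa p q.
Proof. by rewrite addr_ge0 ?mdist_ge0 // mulr_ge0 ?mdist_ge0 // ltW. Qed.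

(** Changing only the first coordinate alters [omega] to each point of the graph by at most
    [mdist u v]. The additive form stays meaningful when both distances are infinite. *)
Lemma dist_gph_Lipschitz (u v : X) (y : Y) :
  (dist (omega kappa) (u, y) (gph F)
     <= (mdist u v)%:E + dist (omega kappa) (v, y) (gph F))%E.
Proof.
rewrite -leeBlDl //; apply/ereal_infP => _ [p Fp <-].
rewrite leeBlDl // (le_trans (dist_le _ _ Fp)) // -EFinD lee_fin.
by rewrite /omega/= addrA lerD2r metric_triangle.
Qed.

(** The right-hand side is the infimum of [omega] over the graph points with first coordinate [x]
    only. *)
Lemma dist_gph_le (x : X) (y : Y) :
  (dist (omega kappa) (x, y) (gph F) <= kappa%:E * dist mdist y (F x))%E.
Proof.
rewrite /dist -ereal_inf_pZl //; apply/ereal_infP => _ [_ [v Fv <-] <-].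
apply: ereal_inf_lbound; exists (x, v) => //.
by rewrite /omega/= mdistxx add0r EFinM.
Qed.

Lemma dist_gph_eq0 (u : X) (y : Y) : closed (gph F) ->
  dist (omega kappa) (u, y) (gph F) = 0%E -> F u y.
Proof.
move=> Fclosed d0; apply: (Fclosed (u, y)) => B.
rewrite -nbhs_ballE => -[e /= e0 eB].
(* Closedness refers to the product topology, so both coordinates must be within [e]. The bound [e]
   on [omega] handles the first; [kappa * e] handles the second, which [omega] weights by
   [kappa]. *)
have re0 : 0 < Num.min e (kappa * e) by rewrite lt_min e0 mulr_gt0.
have [[a b] Fab] :
    exists2 p, gph F p & omega kappa (u, y) p < Num.min e (kappa * e).
  by apply: dist_lt; rewrite d0 lte_fin.
rewrite /omega/= lt_min => /andP[lt_e lt_ke].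
exists (a, b); split => //; apply: eB; split => /=; rewrite ballEmdist /=.
- by apply: le_lt_trans lt_e; rewrite lerDl mulr_ge0 ?mdist_ge0 // ltW.
- rewrite -(ltr_pM2l kappa_gt0); apply: le_lt_trans lt_ke.
  by rewrite lerDr mdist_ge0.
Qed.

End Omega.

Theorem proposition2p9 (R : realType) (X Y : metricType R)
    (kappa khat : R) (W : set (X * Y)) (F : X -> set Y)
    (Xcomplete : complete_metric X)
    (kappa_gt0 : 0 < kappa)
    (le_kappa_khat : kappa <= khat)
    (closed_gph : closed (gph F))
    (dom_meets_W : dom F `&` W.`1 !=set0)
    (descent : forall (u : X) (y : Y), W.`2 y ->
      (exists2 x : X, ysection W y x &
        (0 < dist (omega kappa) (u, y) (gph F)
           <= kappa%:E * dist mdist y (F x)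
              - (kappa / khat * mdist u x)%:E)%E) ->
      exists uhat : X,
        (dist (omega kappa) (uhat, y) (gph F)
           < dist (omega kappa) (u, y) (gph F)
             - (kappa / khat * mdist uhat u)%:E)%E) :
  regular_on F W khat.
Proof.
have khat_gt0 : 0 < khat := lt_le_trans kappa_gt0 le_kappa_khat.
have c0 : 0 < kappa / khat by rewrite divr_gt0.
move=> x y Wxy.
(* If [F x] is empty, the right-hand side is infinite. Otherwise the graph is nonempty and [phi] is
   finite, so [ekeland] applies to [fine \o phi]. *)
have [Fx0|/set0P Fx] := eqVneq (F x) set0.
  by rewrite Fx0 dist_set0 gt0_muley ?lte_fin // leey.
pose phi u := dist (omega kappa) (u, y) (gph F).
have [b Fxb] := Fx.
have phi_fin u : phi u \is a fin_num.
  by apply: dist_fin_num => [q|]; [exact: omega_ge0 | exists (x, b)].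
have Dfin : dist mdist y (F x) \is a fin_num.
  by apply: dist_fin_num => // q; exact: mdist_ge0.
have phi_ge0 u : 0 <= fine (phi u).
  by rewrite fine_ge0 // dist_ge0 //; exact: omega_ge0.
have phi_lip u v : fine (phi u) <= mdist u v + fine (phi v).
  by rewrite -lee_fin EFinD !fineK //; exact: dist_gph_Lipschitz.
have phi_cont : continuous (fine \o phi).
  move=> u; apply/cvgrPdist_lt => e e0.
  have /metricType_numDomainType.cvgrPdist_lt/(_ _ e0) := @cvg_id _ (nbhs u).
  apply: filterS => v /= uv; rewrite ltr_norml.
  have := phi_lip u v; have := phi_lip v u; rewrite (metric_sym v u); lra.
have [u ux umin] := ekeland x Xcomplete phi_cont c0 phi_ge0.
set D := fine (dist mdist y (F x)).
have phix : fine (phi x) <= kappa * D.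
  by rewrite -lee_fin EFinM !fineK //; exact: dist_gph_le.
have phiu : phi u = 0%E.
  apply/eqP; rewrite eq_le dist_ge0 ?andbT; last exact: omega_ge0.
  rewrite leNgt; apply/negP => phiu_gt0.
  (* The reference point of the descent hypothesis is [x] itself: its upper bound is [ux] combined
     with [phix]. The resulting [v] contradicts [umin]. *)
  have [||v] := descent u y.
  - by exists x.
  - exists x; first by rewrite /ysection/= inE.
    rewrite phiu_gt0 /= -/(phi u) -(fineK (phi_fin u)).
    rewrite -(fineK Dfin) -EFinM -EFinB lee_fin -/D.
    by move: ux => /=; lra.
  - rewrite -/(phi v) -/(phi u) -(fineK (phi_fin v)) -(fineK (phi_fin u)).
    by rewrite -EFinB lte_fin; have /= := umin v; lra.
have Fuy : F u y by exact: dist_gph_eq0 phiu.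
apply: (le_trans (dist_le mdist x Fuy)).
(* Multiplying by [kappa / khat] turns the factor [khat] into [kappa], the one in [phix]. *)
rewrite -(fineK Dfin) -EFinM lee_fin -/D -(ler_pM2l c0) metric_sym.
rewrite mulrA divfK ?gt_eqF //.
by move: ux; rewrite /= phiu /=; lra.
Qed.
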